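(* Suppose that $\mathcal{P}\subset\mathbb{N}^\times$ is a nonempty family of (pairwise) relatively prime numbers, all greater than $1$, let $P$ be the free abelian submonoid of $\mathbb{N}^\times$ generated by $\mathcal{P}$, and let $S=\mathbb{N}\rtimes P$ be the semidirect product with multiplication $(m,p)(n,q)=(m+np,pq)$ for $m,n\in\mathbb{N}$, $p,q\in P$. Then the right LCM semigroup $S$ has the following properties: (i) $S$ is admissible, and if $\mathcal{P}$ is finite, then $\beta_c=1$. (ii) $\alpha$ is faithful and almost free. (iii) $S$ has finite propagation.
   Context: Here $\mathbb{N}=\{0,1,2,\dots\}$ (additive), and $\mathbb{N}^\times$ is the multiplicative monoid of positive integers. All semigroups are countable discrete monoids. **Right LCM semigroups.** A monoid $S$ is right LCM if it is left cancellative and for all $s,t\in S$ the set $sS\cap tS$ is empty or of the form $rS$; such $r$ is a right LCM of $s,t$. $S^*$ is the group of invertible elements. $S_c=\{a\in S: aS\cap sS\ne\emptyset\ \forall s\in S\}$. $S_{ci}$ is the set of $s\in S\setminus S_c$ such that every factorisation $s=ta$ with $a\in S_c$ forces $a\in S^*$; $S_{ci}^1=S_{ci}\cup\{1\}$. $s\sim t$ means $sa=tb$ for some $a,b\in S_c$; $[s]$ is the class of $s$. A transversal for $A/_\sim$, $A\subset S$, is a subset of $A$ that is a minimal complete set of representatives. A finite $F\subset S$ is a foundation set if every $s\in S$ satisfies $sS\cap fS\neq\emptyset$ for some $f\in F$; it is accurate if $fS\cap f'S=\emptyset$ for distinct $f,f'\in F$. **Admissibility.** For a submonoid $M$ of $\mathbb{N}^\times$,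 $\mathrm{Irr}(M)$ is the set of $m\in M$, $m\ne1$, such that $m=kl$ with $k,l\in M$ implies $k=1$ or $l=1$. $S$ is admissible if: (A1) $S=S_{ci}^1S_c$; (A2) any right LCM of two elements of $S_{ci}$ belongs to $S_{ci}$; (A3) there is a nontrivial monoid homomorphism $N\colon S\to\mathbb{N}^\times$ (a generalised scale) such that (a) $|N^{-1}(n)/_\sim|=n$ for all $n\in N(S)$ and (b) for each $n\in N(S)$ every transversal of $N^{-1}(n)/_\sim$ is an accurate foundation set for $S$; (A4) $N(S)$ is the free abelian monoid in $\mathrm{Irr}(N(S))$. The critical inverse temperature $\beta_c$ is the smallest value such that $\zeta_S(\beta)=\sum_{n\in N(S)}n^{-(\beta-1)}$ is finite for all real $\beta>\beta_c$. Here the generalised scale on $S=\mathbb{N}\rtimes P$ is $N(m,p)=p$. **The action $\alpha$.** $\alpha\colon S_c\curvearrowright S/_\sim$, $\alpha_a([s])=[as]$. It is faithful if for all $a\neq b$ in $S_c$ there is $x$ with $\alpha_a(x)\neq\alpha_b(x)$, and almost free if $\{x\in S/_\sim:\alpha_a(x)=\alpha_b(x)\}$ is finite for all $a\ne b$ in $S_c$. **Finite propagation.** For an admissible $S$ and a transversal $\mathcal{T}$ for $S/_\sim$ with $\mathcal{T}\subset S_{ci}^1$, each $s\in S$ is uniquely $s=i(s)c(s)$ with $i(s)\in\mathcal{T}$, $c(s)\in S_c$; put $C_a=\{c(af):f\in\mathcal{T}\}$. $S$ has finite propagation if for every $(a,b)\in S_c\times S_c$ there is such a $\mathcal{T}$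 for which $C_a$ and $C_b$ are finite. *)

(* Defs.v *)
From HB Require Import structures.
From mathcomp Require Import all_boot all_order all_algebra.
From mathcomp Require Import monoid.
From mathcomp Require Import all_classical all_reals all_analysis.

Set Implicit Arguments.
Unset Strict Implicit.
Unset Printing Implicit Defensive.

Import Order.TTheory GRing.Theory Num.Theory.

Local Open Scope classical_set_scope.
Local Open Scope card_scope.
Local Open Scope group_scope.

Section RightLCM.
Variable S : monoidType.
Implicit Types (s t r a b c f i : S) (A F T : set S).

Definition left_cancellative := forall s t r, s * t = s * r -> t = r.

Definition right_ideal s : set S := [set s * x | x in [set: S]].

Definition is_right_lcm r s t :=
  right_ideal s `&` right_ideal t = right_ideal r.

Definition right_LCM := left_cancellative /\
  forall s t, right_ideal s `&` right_ideal t = set0 \/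
              exists r, is_right_lcm r s t.

Definition invertible : set S := [set s | exists t, s * t = 1 /\ t * s = 1].

Definition core : set S :=
  [set a | forall s, right_ideal a `&` right_ideal s !=set0].

Definition core_irr : set S :=
  [set s | ~ core s /\ forall t a, core a -> s = t * a -> invertible a].

Definition core_irr1 : set S := core_irr `|` [set 1].

Definition sim s t := exists a b, [/\ core a, core b & s * a = t * b].

Definition sim_class s : set S := [set t | sim s t].

Definition quotient_sim A : set (set S) := [set sim_class s | s in A].

Definition complete_reps T A :=
  T `<=` A /\ forall s, A s -> exists2 t, T t & sim s t.

Definition sim_transversal T A :=
  complete_reps T A /\ forall T', T' `<=` T -> complete_reps T' A -> T' = T.

Definition foundation_set F :=
  finite_set F /\
  forall s, exists2 f, F f & right_ideal s `&` right_ideal f !=set0.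

Definition accurate F :=
  forall f f', F f -> F f' -> f <> f' -> right_ideal f `&` right_ideal f' = set0.

(* The union makes sense for every X; on a class it is alpha_a([s]) = [as],
   see alphaE. *)
Definition alpha a (X : set S) : set S := \bigcup_(s in X) sim_class (a * s).

Definition alpha_faithful := forall a b, core a -> core b -> a <> b ->
  exists2 X, quotient_sim [set: S] X & alpha a X <> alpha b X.

Definition alpha_almost_free := forall a b, core a -> core b -> a <> b ->
  finite_set [set X | quotient_sim [set: S] X /\ alpha a X = alpha b X].

Definition decomposes T s i c := [/\ T i, core c & s = i * c].

(* c(s) for the transversal T; well defined by decomposesP. *)
Definition core_part T s : S :=
  xget 1 [set c | exists i, decomposes T s i c].

Definition core_parts T a : set S := [set core_part T (a * f) | f in T].

Definition finite_propagation := forall a b, core a -> core b ->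
  exists T, [/\ sim_transversal T [set: S], T `<=` core_irr1,
                finite_set (core_parts T a) & finite_set (core_parts T b)].

Definition core_factorable :=
  forall s, exists i a, [/\ core_irr1 i, core a & s = i * a].

Definition core_irr_lcm_closed :=
  forall r s t, core_irr s -> core_irr t -> is_right_lcm r s t -> core_irr r.

End RightLCM.

Arguments core_irr1 {S}.

(* Facts that the notions above presuppose: sim is an equivalence relation,
   alpha acts on classes, i(s) and c(s) exist and are unique. *)
Section Coherence.
Variable S : monoidType.
Hypothesis lcmS : right_LCM S.
Implicit Types (s t r a b c f i : S) (T : set S).

Lemma core1 : core (1 : S).
Proof.
by move=> s; exists s; split; [exists s; rewrite ?mul1g|exists 1; rewrite ?mulg1].
Qed.

Lemma coreM a b : core a -> core b -> core (a * b).
Proof.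
move=> ca cb s; have [_ [[x _ <-] [y _ sy]]] := ca s.
have [_ [[z _ <-] [w _ xw]]] := cb x.
exists (a * b * z); split; first by exists z.
by exists (y * w) => //; rewrite mulgA sy -!mulgA xw.
Qed.

Lemma core_ore a b : core a -> core b ->
  exists x y, [/\ core x, core y & a * x = b * y].
Proof.
have [injS lcm] := lcmS => ca cb.
case: (lcm a b) => [ab0|[r abr]].
  by have [z] := ca b; rewrite ab0.
have rr : right_ideal r r by exists 1; rewrite ?mulg1.
have := rr; rewrite -abr => -[[x _ ax] [y _ by_]].
have cr : core r.
  move=> s; have [_ [[z _ <-] [w _ sw]]] := ca s.
  have [_ [[u _ <-] [v _ buv]]] := cb (a * z).
  have : right_ideal r (b * u).
    by rewrite -abr; split; [exists (z * v); rewrite // mulgA|exists u].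
  move=> ru; exists (b * u); split=> //.
  by exists (w * v) => //; rewrite mulgA sw.
have pref d e : d * e = r -> core e.
  move=> de s; have [_ [[z _ <-] [w _ sw]]] := cr (d * s).
  exists (e * z); split; first by exists z.
  by exists w => //; apply: (injS d); rewrite !mulgA sw de.
by exists x, y; split; [exact: pref ax|exact: pref by_|rewrite ax by_].
Qed.

Lemma sim_refl s : sim s s.
Proof. by exists 1, 1; split => //; exact: core1. Qed.

Lemma sim_sym s t : sim s t -> sim t s.
Proof. by move=> [a [b [ca cb sab]]]; exists b, a. Qed.

Lemma sim_trans s t r : sim s t -> sim t r -> sim s r.
Proof.
move=> [a [b [ca cb sab]]] [c [d [cc cd tcd]]].
have [x [y [cx cy bxy]]] := core_ore cb cc.
exists (a * x), (d * y); split; [exact: coreM|exact: coreM|].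
by rewrite mulgA sab -mulgA bxy !mulgA tcd.
Qed.

Lemma sim_classP s t : sim_class s = sim_class t <-> sim s t.
Proof.
split=> [st|st]; first by have : sim_class t t := sim_refl t; rewrite -st.
apply/seteqP; split=> r /=; first exact/sim_trans/sim_sym.
exact: sim_trans.
Qed.

Lemma alphaE a s : alpha a (sim_class s) = sim_class (a * s).
Proof.
have simM t r : sim t r -> sim (a * t) (a * r).
  by move=> [x [y [cx cy xy]]]; exists x, y; rewrite -!mulgA xy.
apply/seteqP; split=> [r [t st] atr|r asr]; last by exists s => //; exact: sim_refl.
exact: sim_trans (simM _ _ st) atr.
Qed.

Lemma sim_transversal_uniq T (A : set S) s t :
  sim_transversal T A -> T s -> T t -> sim s t -> s = t.
Proof.
move=> [[TA repT] minT] Ts Tt st; apply: contrapT => neq.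
have /(minT _ _) : complete_reps (T `\ t) A.
  split=> [x [/TA]//|x /repT[y Ty xy]].
  have [yt|yt] := pselect (y = t); last by exists y.
  by exists s => //; apply: sim_trans xy _; rewrite yt; exact: sim_sym.
by move=> /(_ (@subDsetl _ _ _)) TtE; move: Tt; rewrite -TtE => -[_]; apply.
Qed.

Lemma decomposesP T s : core_factorable S -> core_irr_lcm_closed S ->
    sim_transversal T [set: S] -> T `<=` core_irr1 ->
  exists2 ic, decomposes T s ic.1 ic.2 &
    forall i c, decomposes T s i c -> (i, c) = ic.
Proof.
have [injS lcm] := lcmS.
move=> factS lcmI trT TI.
have [j [a [Ij ca sja]]] := factS s.
have [[_ repT] _] := trT.
have [i Ti [x [y [cx cy jxiy]]]] := repT j Logic.I.
have [u cu ju] : exists2 u, core u & j = i * u.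
  have core_pre (u v : S) : core (u * v) -> core u.
    by move=> cuv r; have [_ [[z _ <-] rz]] := cuv r;
       exists (u * v * z); split=> //; exists (v * z); rewrite // mulgA.
  case: Ij => [Ij|j1]; last first.
    case: (TI _ Ti) => [[ni _]|->].
      by case: ni; apply: (core_pre _ y); rewrite -jxiy j1 mul1g.
    by exists 1; [exact: core1|rewrite j1 mulg1].
  case: (TI _ Ti) => [Ii|i1]; last first.
    case: Ij => nj _; case: nj; apply: (core_pre _ x).
    by rewrite jxiy i1 mul1g.
  case: (lcm j i) => [ji0|[r jir]].
    suff : set0 (j * x) by [].
    by rewrite -ji0; split; [exists x|exists y].
  have [_ irr_r] := lcmI _ _ _ Ij Ii jir.
  have : right_ideal r r by exists 1; rewrite ?mulg1.
  rewrite -{1}jir => -[[u _ jur] [v _ ivr]].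
  have : right_ideal r (j * x).
    by rewrite -jir; split; [exists x|exists y].
  move=> [z _ rz].
  have cu : core u.
    by apply: (core_pre _ z); rewrite (_ : u * z = x) //; apply: (injS j);
       rewrite mulgA jur.
  have cv : core v.
    apply: (core_pre _ z); rewrite (_ : v * z = y) //; apply: (injS i).
    by rewrite mulgA ivr rz jxiy.
  have [u' [uu' u'u]] := irr_r _ _ cu (esym jur).
  exists (v * u'); last by rewrite mulgA ivr -jur -mulgA uu' mulg1.
  apply: coreM => // t; exists t; split; last by exists 1; rewrite ?mulg1.
  by exists (u * t) => //; rewrite mulgA u'u mul1g.
exists (i, u * a); first by split => //=; [exact: coreM|rewrite mulgA -ju].
move=> k d [Tk cd skd].
have ki : k = i.
  apply: (sim_transversal_uniq trT) => //.
  by exists d, (u * a); split=> //; [exact: coreM|rewrite -skd mulgA -ju].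
congr pair => //; apply: (injS i).
by rewrite -{1}ki -skd mulgA -ju.
Qed.

End Coherence.

Local Open Scope nat_scope.

(* Submonoids of the multiplicative monoid of positive integers are sets of
   natural numbers; all the generators considered are positive. *)
Definition submonoid (X : set nat) : set nat :=
  [set n | exists2 s : seq nat, (forall x, x \in s -> X x) & n = \prod_(x <- s) x].

Definition Irr (M : set nat) : set nat :=
  [set m | [/\ M m, m <> 1 &
     forall k l, M k -> M l -> m = k * l -> k = 1 \/ l = 1]].

(* Finite sequences up to permutation are the finite multisets in X, i.e. the
   elements of the free abelian monoid on X. *)
Definition free_abelian_on (M X : set nat) :=
  M = submonoid X /\
  forall s t : seq nat,
    (forall x, x \in s -> X x) -> (forall x, x \in t -> X x) ->
    \prod_(x <- s) x = \prod_(x <- t) x -> perm_eq s t.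

Section Admissible.
Variable S : monoidType.
Implicit Types N : S -> nat.

Definition scale_hom N :=
  [/\ forall s, 0 < N s, N 1%g = 1 & forall s t, N (s * t)%g = N s * N t].

Definition generalised_scale N :=
  [/\ scale_hom N,
      exists s, N s <> 1,
      forall n, range N n -> quotient_sim (N @^-1` [set n]) #= `I_n &
      forall n, range N n -> forall T, sim_transversal T (N @^-1` [set n]) ->
        foundation_set T /\ accurate T].

Definition admissible N :=
  [/\ core_factorable S, core_irr_lcm_closed S, generalised_scale N &
      free_abelian_on (range N) (Irr (range N))].

Local Open Scope ring_scope.
Local Open Scope ereal_scope.

Definition zeta (R : realType) N (beta : R) : \bar R :=
  (\esum_(n in range N) (n%:R `^ (- (beta - 1)))%:E)%R.

Definition zeta_finite_above (R : realType) N (b : \bar R) :=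
  forall beta : R, b < beta%:E -> zeta N beta < +oo.

Definition critical_inverse_temperature (R : realType) N (b : \bar R) :=
  zeta_finite_above N b /\
  forall b' : \bar R, zeta_finite_above N b' -> b <= b'.

End Admissible.

Section Semidirect.
Variable X : set nat.

Lemma submonoid1 : 1 \in submonoid X.
Proof. by rewrite inE; exists [::]; rewrite ?big_nil. Qed.

Lemma submonoidM m n :
  m \in submonoid X -> n \in submonoid X -> m * n \in submonoid X.
Proof.
rewrite !inE => -[s sX ->] [t tX ->]; exists (s ++ t); last by rewrite big_cat.
by move=> x; rewrite mem_cat => /orP[/sX|/tX].
Qed.

Definition semidirect : Type := nat * set_type (submonoid X).

HB.instance Definition _ := Choice.on semidirect.

Implicit Types x y z : semidirect.

Definition sd_one : semidirect := (0, exist _ 1 submonoid1).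

Definition sd_mul x y : semidirect :=
  (x.1 + val x.2 * y.1,
   exist _ (val x.2 * val y.2) (submonoidM (valP x.2) (valP y.2))).

Definition sd_scale x : nat := val x.2.

Lemma sd_mulA : associative sd_mul.
Proof.
move=> [m p] [n q] [k r]; congr pair; last by apply: val_inj; rewrite /= mulnA.
by rewrite /= mulnDr addnA mulnA.
Qed.

Lemma sd_mul1 : left_id sd_one sd_mul.
Proof.
move=> [m p]; congr pair; first by rewrite /= add0n mul1n.
by apply: val_inj; rewrite /= mul1n.
Qed.

Lemma sd_mulr1 : right_id sd_one sd_mul.
Proof.
move=> [m p]; congr pair; first by rewrite /= muln0 addn0.
by apply: val_inj; rewrite /= muln1.
Qed.

HB.instance Definition _ := isMonoid.Build semidirect sd_mulA sd_mul1 sd_mulr1.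

End Semidirect.

(* Main.v *)
Require Import Defs.
From HB Require Import structures.
From mathcomp Require Import all_boot all_order all_algebra.
From mathcomp Require Import monoid.
From mathcomp Require Import all_classical all_reals all_analysis.

Set Implicit Arguments.
Unset Strict Implicit.
Unset Printing Implicit Defensive.

Import Order.TTheory GRing.Theory Num.Theory.
Local Open Scope classical_set_scope.

(** Write [P] for the submonoid generated by the family [X] of pairwise coprime
    numbers, and [(m, p)] for an element of [S], with [m] in [nat] and [p] in
    [P].  The proposition rests on two facts.

    Arithmetic.  An element [x] of [X] is coprime to every product of other
    elements of [X], so [x ^ k] divides a product of generators exactly when
    [x] occurs in it at least [k] times ([exp_dvd_prod]).  Hence factorisations
    into generators are unique, [P] is free with irreducibles [X], and [P] is
    closed under least common multiples and under those quotients that are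
    integers.  In [P], divisibility and lcm therefore agree with those of the
    integers, although the elements of [X] need not be prime.

    Geometry of ideals.  By the second closure property, the right ideal of
    [(m, p)] consists of the [(k, r)] such that [k] lies in the progression
    [m + p nat] and [p] divides [r] ([right_ideal_sd]).  Everything about [S]
    is then a statement on arithmetic progressions.  Two of them that meet, do
    so in a progression whose step is the lcm of the steps, so [S] is right LCM.
    The core is [p = 1], the core irreducible elements are those with [m < p]
    and [1 < p], and [(m, p)] is equivalent to [(n, q)] exactly when [p = q]
    and [m = n] modulo [p].  So a fibre of the scale has one class for each
    residue, a core element [a = (k, 1)] acts on the residues modulo [p] as
    translation by [k], and the euclidean division [m = (m %/ p) * p + m %% p]
    is the factorisation of [(m, p)] into a core irreducible element (or the unit,
    if [p = 1]) and a core part.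

    Two core elements that translate by [k] and [l], with [k] different from
    [l], agree exactly on the classes whose [p] divides [k - l]: finitely many,
    and not all since [P] is unbounded.  Translating a residue
    [m < p] by [k] gives less than [k + p], so the core part is at most [k],
    whatever [p] is; this is finite propagation.

    For finite [X] the zeta function is a finite product of convergent geometric
    series when [1 < beta] ([zeta_fin]), and at [beta = 1] it counts the
    infinite set [P] ([zeta_1]).  So the critical value is [1]. *)

(** * Monoids generated by pairwise coprime numbers *)

Section Arithmetic.
Variable X : set nat.
Hypothesis X_gt1 : forall p, X p -> 1 < p.
Hypothesis X_coprime : forall p q, X p -> X q -> p <> q -> coprime p q.
Implicit Types s t : seq nat.

Let inX s := forall x, x \in s -> X x.

Lemma prod_gens_gt0 s : inX s -> 0 < \prod_(x <- s) x.
Proof.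
move=> sX; rewrite big_seq_cond; apply: prodn_cond_gt0 => x.
by rewrite andbT => /sX/X_gt1/ltnW.
Qed.

Lemma submonoid_gt0 n : submonoid X n -> 0 < n.
Proof. by move=> [s /prod_gens_gt0 ? ->]. Qed.

Lemma submonoid_gen p : X p -> submonoid X p.
Proof.
move=> Xp; exists [:: p]; last by rewrite big_seq1.
by move=> x; rewrite inE => /eqP->.
Qed.

Lemma submonoid_one : submonoid X 1.
Proof. by exists [::]; rewrite ?big_nil. Qed.

Lemma submonoid_mul m n : submonoid X m -> submonoid X n -> submonoid X (m * n).
Proof. by move=> /mem_set Xm /mem_set Xn; exact/set_mem/submonoidM. Qed.

Lemma submonoid_exp p k : X p -> submonoid X (p ^ k).
Proof.
move=> Xp; elim: k => [|k IH]; first exact: submonoid_one.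
by rewrite expnS; apply: submonoid_mul => //; exact: submonoid_gen.
Qed.

Lemma coprime_prod p s :
  X p -> inX s -> p \notin s -> coprime p (\prod_(x <- s) x).
Proof.
move=> Xp sX ps; rewrite big_seq; elim/big_ind: _ => [|m n|x xs].
- exact: coprimen1.
- by rewrite coprimeMr => -> ->.
- by apply: X_coprime (sX _ xs) _ => // px; rewrite px xs in ps.
Qed.

Lemma prod_count p s : \prod_(x <- s) x =
  p ^ count_mem p s * \prod_(x <- [seq x <- s | x != p]) x.
Proof.
rewrite (bigID (pred1 p))/= big_filter; congr (_ * _).
elim: s => [|x s IH]; first by rewrite big_nil.
by rewrite big_cons /= IH; case: eqP => //= ->; rewrite add1n expnS.
Qed.

(** The multiplicity of a generator in a product can be read off from
    divisibility by its powers, since the other factors are coprime to it. *)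
Lemma exp_dvd_prod p k s :
  X p -> inX s -> (p ^ k %| \prod_(x <- s) x) = (k <= count_mem p s).
Proof.
move=> Xp sX; rewrite (prod_count p) Gauss_dvdl ?dvdn_Pexp2l ?X_gt1//.
apply/coprimeXl/coprime_prod => //; last by rewrite mem_filter eqxx.
by move=> x; rewrite mem_filter => /andP[_ /sX].
Qed.

Lemma count_notin p s : ~ X p -> inX s -> count_mem p s = 0.
Proof. by move=> nXp sX; apply/count_memPn/negP => /sX. Qed.

(** Divisibility between products is inclusion of multisets of factors: the
    quotient is again a product of generators. *)
Lemma prod_dvd_subseq s t : inX s -> inX t ->
  \prod_(x <- s) x %| \prod_(x <- t) x -> exists u, perm_eq t (s ++ u).
Proof.
move=> sX tX st; have [|r rt sr] := (count_subseqP s t).1.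
  move=> p; have [Xp|nXp] := pselect (X p); last by rewrite !count_notin.
  by rewrite -exp_dvd_prod//; apply: dvdn_trans st; rewrite exp_dvd_prod.
have [u tru] := perm_to_subseq rt; exists u.
by rewrite (perm_trans tru)// perm_cat2r perm_sym.
Qed.

Lemma prod_inj s t : inX s -> inX t ->
  \prod_(x <- s) x = \prod_(x <- t) x -> perm_eq s t.
Proof.
move=> sX tX st.
have le_count s' t' p : inX s' -> inX t' ->
    \prod_(x <- s') x = \prod_(x <- t') x -> count_mem p s' <= count_mem p t'.
  move=> sX' tX' st'.
  have [Xp|nXp] := pselect (X p); last by rewrite !count_notin.
  by rewrite -exp_dvd_prod// -st' exp_dvd_prod.
by apply/allP => p _ /=; rewrite eqn_leq !le_count.
Qed.

Lemma submonoid_div m n : submonoid X m -> submonoid X n -> m %| n ->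
  submonoid X (n %/ m).
Proof.
move=> [s sX ->] [t tX ->] /(prod_dvd_subseq sX tX)[u tsu].
exists u => [x xu|]; first by apply: tX; rewrite (perm_mem tsu) mem_cat xu orbT.
by rewrite (perm_big _ tsu)/= big_cat/= mulKn// prod_gens_gt0.
Qed.

(** The factors of [m] are moved out of the lcm in turn.  A factor [x] that
    also occurs in [n] is a common factor of both arguments; otherwise [x] is
    coprime to [n] and does not change the gcd. *)
Lemma submonoid_lcm m n : submonoid X m -> submonoid X n ->
  submonoid X (lcmn m n).
Proof.
move=> [s sX ->] [t].
elim: s t n sX => [|x s IH] t n sX tX ->.
  by rewrite big_nil lcm1n; exists t.
have Xx : X x by apply: sX; rewrite mem_head.
have sX' : inX s by move=> y ys; apply: sX; rewrite inE ys orbT.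
rewrite big_cons; have [xt|xt] := boolP (x \in t).
  rewrite (perm_big _ (perm_to_rem xt))/= big_cons -muln_lcmr.
  apply: submonoid_mul; first exact: submonoid_gen.
  by apply: (IH (rem x t)) => // y /mem_rem/tX.
rewrite (_ : lcmn _ _ = x * lcmn (\prod_(j <- s) j) (\prod_(j <- t) j)).
  by apply: submonoid_mul; [exact: submonoid_gen|exact: (IH t)].
rewrite /lcmn gcdnC Gauss_gcdr; last by rewrite coprime_sym coprime_prod.
by rewrite gcdnC -mulnA muln_divA// dvdn_mulr// dvdn_gcdl.
Qed.

Lemma Irr_submonoid : Irr (submonoid X) = X.
Proof.
apply/seteqP; split=> [m [[s sX ->] s1 irr]|p Xp].
  case: s => [|x s] in sX s1 irr *; first by rewrite big_nil in s1.
  have Xx : X x by apply: sX; rewrite mem_head.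
  rewrite big_cons in irr *.
  case: (irr x (\prod_(j <- s) j)) => //; first exact: submonoid_gen.
  - by exists s => // y ys; apply: sX; rewrite inE ys orbT.
  - by move=> x1; move: (X_gt1 Xx); rewrite x1.
  - by move=> ->; rewrite muln1.
split; [exact: submonoid_gen|by move=> p1; move: (X_gt1 Xp); rewrite p1|].
move=> _ _ [s sX ->] [t tX ->] pst.
have /prod_inj/perm_size : \prod_(x <- [:: p]) x = \prod_(x <- s ++ t) x.
  by rewrite big_seq1 big_cat.
case: s sX {pst} => [|x s] sX; first by rewrite big_nil; left.
case: t tX => [|y t] tX; first by rewrite big_nil; right.
rewrite /= size_cat /= addnS => H.
suff : 1 = (size s + size t).+2 by []; apply: H => z.
- by rewrite inE => /eqP->.
- by rewrite -cat_cons mem_cat => /orP[/sX|/tX].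
Qed.

Lemma submonoid_free : free_abelian_on (submonoid X) (Irr (submonoid X)).
Proof. by rewrite Irr_submonoid; split => // s t; exact: prod_inj. Qed.

End Arithmetic.

(** * Ideals, core and equivalence in the semidirect product *)

(** If the representatives are pairwise inequivalent, each is the only one of its
    class, so none can be left out. *)
Lemma sim_transversal_of_inj (S : monoidType) (T A : set S) :
  complete_reps T A -> (forall s t, T s -> T t -> sim s t -> s = t) ->
  sim_transversal T A.
Proof.
move=> repT injT; split=> // T' T'T [_ repT'].
apply/seteqP; split=> // t Tt.
have [t' T't' tt'] := repT' t (repT.1 t Tt).
by rewrite (injT t t' Tt (T'T _ T't') tt').
Qed.

Section Semidirect.
Variable X : set nat.
Hypothesis X_gt1 : forall p, X p -> 1 < p.
Hypothesis X_coprime : forall p q, X p -> X q -> p <> q -> coprime p q.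
Local Notation S := (semidirect X).
Local Notation scale := (@sd_scale X).
Implicit Types (s t r a b : S) (T : set S).

Definition sd_pair m n (Xn : submonoid X n) : S := (m, exist _ n (mem_set Xn)).

Lemma sd_scaleP s : submonoid X (scale s).
Proof. exact: set_mem (valP s.2). Qed.

Lemma sd_scale_gt0 s : 0 < scale s.
Proof. exact: submonoid_gt0 X_gt1 _ (sd_scaleP s). Qed.

Lemma sd_eq s t : s.1 = t.1 -> scale s = scale t -> s = t.
Proof.
by case: s t => [m p] [n q] /= mn pq; congr pair => //; exact: val_inj.
Qed.

Lemma fst_sd_mul s t : (s * t)%g.1 = s.1 + scale s * t.1. Proof. by []. Qed.

Lemma sd_scaleM s t : scale (s * t)%g = scale s * scale t. Proof. by []. Qed.

(** The explicit form of right ideals on which all later computations rest.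
    The converse needs the quotient of the scales to be in the submonoid. *)
Lemma right_ideal_sd s t : right_ideal s t <->
  [/\ s.1 <= t.1, t.1 = s.1 %[mod scale s] & scale s %| scale t].
Proof.
split=> [[x _ <-]|[st /eqP tmod sdvd]].
  rewrite fst_sd_mul sd_scaleM leq_addr dvdn_mulr//; split => //.
  by rewrite -modnDmr modnMr addn0.
move: tmod; rewrite eqn_mod_dvd// => tmod.
exists (sd_pair ((t.1 - s.1) %/ scale s)
  (submonoid_div X_gt1 X_coprime (sd_scaleP s) (sd_scaleP t) sdvd)) => //.
apply: sd_eq; first by rewrite fst_sd_mul /= mulnC divnK// subnKC.
by rewrite sd_scaleM /sd_scale /= mulnC divnK.
Qed.

Lemma left_cancellative_sd : left_cancellative S.
Proof.
move=> s t r str; have s0 := sd_scale_gt0 s.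
have := congr1 (fun x : S => x.1) str; rewrite !fst_sd_mul => /addnI/eqP.
rewrite eqn_pmul2l// => /eqP tr; apply: sd_eq => //.
have := congr1 scale str; rewrite !sd_scaleM => /eqP.
by rewrite eqn_pmul2l// => /eqP.
Qed.

(** Two progressions that meet have as intersection the progression that starts
    at their least common point, with the lcm of the steps as step. *)
Lemma right_LCM_sd : right_LCM S.
Proof.
split; first exact: left_cancellative_sd.
move=> s t.
pose meets k := [&& s.1 <= k, t.1 <= k, k == s.1 %[mod scale s] &
                   k == t.1 %[mod scale t]].
have meetsP r : (right_ideal s `&` right_ideal t) r <->
    meets r.1 /\ lcmn (scale s) (scale t) %| scale r.
  rewrite dvdn_lcm; split.
    move=> [/right_ideal_sd[? ? ->] /right_ideal_sd[? ? ->]]; split=> //.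
    by apply/and4P; split=> //; exact/eqP.
  move=> [/and4P[? ? /eqP ? /eqP ?] /andP[? ?]].
  by split; apply/right_ideal_sd.
have [[r str]|] := pselect (right_ideal s `&` right_ideal t !=set0); last first.
  by move=> /set0P/negP/negPn/eqP; left.
right; have [mr rl] := (meetsP r).1 str.
(* [k] is the least point of both progressions *)
have [k mk kmin] := ex_minnP (ex_intro meets r.1 mr).
pose l := sd_pair k (submonoid_lcm X_coprime (sd_scaleP s) (sd_scaleP t)).
exists l; apply/seteqP; split=> x.
  move=> /meetsP[mx xl]; have kx := kmin _ mx; apply/right_ideal_sd; split => //=.
  rewrite /sd_scale /=.
  move: mx mk => /and4P[_ _ /eqP xs /eqP xt] /and4P[_ _ /eqP ks /eqP kt].
  apply/eqP; rewrite eqn_mod_dvd // dvdn_lcm -!eqn_mod_dvd //.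
  by rewrite xs xt ks kt !eqxx.
move=> /right_ideal_sd[/= kx xk lx]; apply/meetsP; split => //.
have modl d : d %| lcmn (scale s) (scale t) -> x.1 = k %[mod d].
  by move=> dl; rewrite -(modn_dvdm x.1 dl) -(modn_dvdm k dl) xk.
move: mk => /and4P[sk tk /eqP ks /eqP kt].
rewrite /meets (leq_trans sk kx) (leq_trans tk kx)/= !modl ?dvdn_lcml ?dvdn_lcmr//.
by rewrite ks kt !eqxx.
Qed.

(** If [(m, p)] is in the core, its ideal meets that of [(m + 1, p)], so [p]
    divides [1]. *)
Lemma core_sd s : core s <-> scale s = 1.
Proof.
split=> [cs|s1 t].
  have [x [/right_ideal_sd[_ xs _] /right_ideal_sd[_ /= xs1 _]]] :=
    cs (sd_pair s.1.+1 (sd_scaleP s)).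
  move: xs; rewrite xs1 /sd_scale/= => /eqP.
  by rewrite eqn_mod_dvd// subSnn dvdn1 => /eqP.
exists (sd_pair (s.1 * scale t + t.1) (sd_scaleP t)); split.
  apply/right_ideal_sd; rewrite s1 !modn1 dvd1n; split => //=.
  by rewrite (leq_trans (leq_pmulr _ (sd_scale_gt0 t)))// leq_addr.
by apply/right_ideal_sd; rewrite /= leq_addl modnMDl.
Qed.

Lemma invertible_sd s : scale s = 1 -> s.1 = 0 -> invertible s.
Proof. by move=> s1 s0; exists 1%g; rewrite mulg1 mul1g; split; apply: sd_eq. Qed.

(** The factors [i(s)] and [c(s)] of [s], given by euclidean division of the
    additive component by the scale. *)
Definition sd_int_part s : S := sd_pair (s.1 %% scale s) (sd_scaleP s).
Definition sd_core_part s : S := sd_pair (s.1 %/ scale s) (submonoid_one X).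

Lemma sd_int_coreE s : s = (sd_int_part s * sd_core_part s)%g.
Proof.
apply: sd_eq; last by rewrite sd_scaleM /sd_scale/= muln1.
by rewrite fst_sd_mul /= addnC mulnC -divn_eq.
Qed.

Lemma core_irr_sd s : core_irr s <-> 1 < scale s /\ s.1 < scale s.
Proof.
split=> [[/core_sd ns irr]|[s1 ss]].
  have s1 : 1 < scale s by rewrite ltn_neqAle eq_sym sd_scale_gt0 andbT; exact/eqP.
  split => //.
  have [|y [/(congr1 (fun x : S => x.1))]] :=
    irr (sd_int_part s) (sd_core_part s) _ (sd_int_coreE s); first exact/core_sd.
  rewrite fst_sd_mul => /eqP; rewrite addn_eq0 => /andP[+ _] _.
  by rewrite -leqn0 leqNgt divn_gt0 ?sd_scale_gt0// -ltnNge.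
split=> [/core_sd s1'|t a /core_sd a1 sta]; first by rewrite s1' in s1.
move: ss; rewrite sta fst_sd_mul sd_scaleM a1 muln1 => H.
apply: invertible_sd => //; apply/eqP; rewrite -leqn0 leqNgt; apply/negP => a0.
by move: H; rewrite ltnNge (leq_trans (leq_pmulr _ a0))// leq_addl.
Qed.

Lemma core_irr1_sd s : core_irr1 s <-> s.1 < scale s.
Proof.
split=> [[/core_irr_sd[]//|-> //]|ss].
have [s1|s1] := eqVneq (scale s) 1.
  by right; apply: sd_eq => //; apply/eqP; move: ss; rewrite s1 ltnS leqn0.
by left; apply/core_irr_sd; rewrite ltn_neqAle eq_sym s1 sd_scale_gt0.
Qed.

Lemma core_factorable_sd : core_factorable S.
Proof.
move=> s; exists (sd_int_part s), (sd_core_part s); split.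
- by apply/core_irr1_sd; rewrite /= ltn_mod sd_scale_gt0.
- exact/core_sd.
- exact: sd_int_coreE.
Qed.

(** If the additive component of the lcm were at least its scale, then it could be
    lowered by that scale: the result would still lie in both progressions, as
    they start below their steps, against the minimality of the lcm. *)
Lemma core_irr_lcm_closed_sd : core_irr_lcm_closed S.
Proof.
move=> r s t /core_irr_sd[s1 ss] /core_irr_sd[_ tt] str.
have rr : right_ideal r r by exists 1%g; rewrite ?mulg1.
have r0 := sd_scale_gt0 r.
have := rr; rewrite -str => -[/right_ideal_sd[sr rs sdr] /right_ideal_sd[tr rt tdr]].
apply/core_irr_sd; split; first exact: leq_trans s1 (dvdn_leq r0 sdr).
rewrite ltnNge; apply/negP => rlt.
pose r' := sd_pair (r.1 - scale r) (sd_scaleP r).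
have shift (u : S) : u.1 < scale u -> u.1 <= r.1 -> r.1 = u.1 %[mod scale u] ->
    scale u %| scale r -> right_ideal u r'.
  move=> uu ur ru udr.
  have r'u : r.1 - scale r = u.1 %[mod scale u].
    rewrite -ru -[in RHS](subnK rlt) -modnDmr.
    by move: udr => /eqP->; rewrite addn0.
  apply/right_ideal_sd; split => //=.
  by rewrite -(modn_small uu) -r'u leq_mod.
have : right_ideal r r' by rewrite -str; split; exact: shift.
move=> /right_ideal_sd[/= + _ _].
by rewrite leqNgt ltn_subrL r0 (leq_trans r0 rlt).
Qed.

(** When [s] and [t] have the same scale [p] and congruent additive components,
    multiplying each by the quotient of the other by [p] makes them equal. *)
Lemma sim_sd s t : sim s t <-> scale s = scale t /\ s.1 = t.1 %[mod scale s].
Proof.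
split=> [[a [b [/core_sd a1 /core_sd b1 satb]]]|[st smod]].
  have := congr1 scale satb; rewrite !sd_scaleM a1 b1 !muln1 => st; split => //.
  have := congr1 (fun x : S => x.1 %% scale s) satb.
  by rewrite !fst_sd_mul -st !(addnC _ (scale s * _)) !(mulnC (scale s)) !modnMDl.
exists (sd_pair (t.1 %/ scale s) (submonoid_one X)),
  (sd_pair (s.1 %/ scale s) (submonoid_one X)); split; [exact/core_sd..|].
apply: sd_eq; rewrite ?sd_scaleM ?st// !fst_sd_mul /= -st !(mulnC (scale s)).
rewrite [in LHS](divn_eq s.1 (scale s)) [in RHS](divn_eq t.1 (scale s)) smod.
by rewrite addnAC (addnC (s.1 %/ _ * _)) addnAC.
Qed.

(** * The generalised scale, the action of the core, and propagation *)

Lemma range_sd_scale : range scale = submonoid X.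
Proof.
apply/seteqP; split=> [_ [s _ <-]|n Xn]; first exact: sd_scaleP.
by exists (sd_pair 0 Xn).
Qed.

Lemma card_quotient_sd n : submonoid X n ->
  (quotient_sim (scale @^-1` [set n]) #= `I_n)%card.
Proof.
move=> Xn; have n0 := submonoid_gt0 X_gt1 Xn.
pose f m := sim_class (sd_pair m Xn).
have -> : quotient_sim (scale @^-1` [set n]) = f @` `I_n.
  apply/seteqP; split=> [_ [s /= sn <-]|_ [m _ <-]]; last by exists (sd_pair m Xn).
  exists (s.1 %% n); first by rewrite /= ltn_mod.
  apply/(sim_classP right_LCM_sd)/sim_sd; split=> //=.
  by rewrite modn_mod.
apply: inj_card_eq => m m' /set_mem/= mn /set_mem/= m'n.
move=> /(sim_classP right_LCM_sd)/sim_sd[_] /=.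
by rewrite /sd_scale/= !modn_small.
Qed.

(** A transversal has an element in each residue class modulo [n]; the ideal of
    [s] meets that of the representative of the class of [s.1].  There are finitely
    many residues, so [T] is finite. *)
Lemma transversal_foundation_set n T : submonoid X n ->
  sim_transversal T (scale @^-1` [set n]) -> foundation_set T.
Proof.
move=> Xn trT; have n0 := submonoid_gt0 X_gt1 Xn.
have [[Tn repT] _] := trT; split; last first.
  move=> s; have s0 := sd_scale_gt0 s.
  have [|f Tf /sim_sd[/= nf sf]] := repT (sd_pair s.1 Xn); first by [].
  exists f => //.
  (* [s.1] shifted by a multiple of both steps, large enough to exceed [f.1] *)
  exists (sd_pair (scale s * n * f.1 + s.1) (submonoid_mul (sd_scaleP s) Xn)).
  split; apply/right_ideal_sd; split=> /=.
  - exact: leq_addl.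
  - by rewrite -mulnA mulnC modnMDl.
  - exact: dvdn_mulr.
  - by rewrite (leq_trans _ (leq_addr _ _))// leq_pmull// muln_gt0 s0.
  - by rewrite (Tn _ Tf) mulnAC modnMDl.
  - by rewrite (Tn _ Tf) dvdn_mull.
have injT : {in T &, injective (fun s => s.1 %% n)}.
  move=> s t /set_mem Ts /set_mem Tt st.
  apply: (sim_transversal_uniq right_LCM_sd trT) => //.
  by apply/sim_sd; rewrite (Tn _ Ts) (Tn _ Tt).
rewrite -(eq_finite_set (inj_card_eq injT)).
apply: sub_finite_set (finite_II n) => _ [s _ <-] /=.
by rewrite ltn_mod.
Qed.

Lemma transversal_accurate n T :
  sim_transversal T (scale @^-1` [set n]) -> accurate T.
Proof.
move=> trT s t Ts Tt st; apply/seteqP; split=> // r.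
have [[Tn _] _] := trT.
move=> [/right_ideal_sd[_ rs _] /right_ideal_sd[_ rt _]].
apply/st/(sim_transversal_uniq right_LCM_sd trT) => //.
apply/sim_sd; move: rs rt.
by rewrite (Tn _ Ts) (Tn _ Tt) => -> ->.
Qed.

Lemma scale_hom_sd : scale_hom scale.
Proof. by split=> // s; exact: sd_scale_gt0. Qed.

Lemma generalised_scale_sd : X !=set0 -> generalised_scale scale.
Proof.
move=> [p Xp]; split; first exact: scale_hom_sd.
- exists (sd_pair 0 (submonoid_gen Xp)); rewrite /sd_scale /= => p1.
  by move: (X_gt1 Xp); rewrite p1.
- by move=> n; rewrite range_sd_scale; exact: card_quotient_sd.
- rewrite range_sd_scale => n Xn T trT; split.
  exact: transversal_foundation_set trT.
  exact: transversal_accurate trT.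
Qed.

Lemma admissible_sd : X !=set0 -> admissible scale.
Proof.
move=> X0; split.
- exact: core_factorable_sd.
- exact: core_irr_lcm_closed_sd.
- exact: generalised_scale_sd.
- by rewrite range_sd_scale; exact: submonoid_free.
Qed.

(** A core element acts on residues as a translation, and translations agree at
    one residue if and only if they agree everywhere. *)
Lemma alpha_sd a b s : core a -> core b ->
  alpha a (sim_class s) = alpha b (sim_class s) <-> a.1 = b.1 %[mod scale s].
Proof.
move=> /core_sd a1 /core_sd b1.
rewrite !(alphaE right_LCM_sd) (sim_classP right_LCM_sd).
rewrite sim_sd !sd_scaleM !fst_sd_mul a1 b1 !mul1n; split=> [[_ /eqP]|/eqP ab].
  by rewrite eqn_modDr => /eqP.
by split=> //; apply/eqP; rewrite eqn_modDr.
Qed.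

Lemma finite_sd_box K : finite_set [set s : S | s.1 <= K /\ scale s <= K].
Proof.
have inj : {in [set s : S | s.1 <= K /\ scale s <= K] &,
    injective (fun s : S => (s.1, scale s))}.
  by move=> s t _ _ [st1 st2]; exact: sd_eq.
rewrite -(eq_finite_set (inj_card_eq inj)).
apply: sub_finite_set (finite_setX (finite_II K.+1) (finite_II K.+1)).
by move=> _ [s [s1 s2] <-]; split; rewrite /= ltnS.
Qed.

(** A modulus larger than both additive components separates them. *)
Lemma alpha_faithful_sd : X !=set0 -> alpha_faithful S.
Proof.
move=> [x Xx] a b ca cb ab.
pose p := x ^ (a.1 + b.1); have plt : a.1 + b.1 < p by rewrite ltn_expl ?X_gt1.
have Xp : submonoid X p by exact: submonoid_exp.
exists (sim_class (sd_pair 0 Xp)); first by exists (sd_pair 0 Xp).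
move=> /(alpha_sd _ ca cb); rewrite /sd_scale/=.
rewrite !modn_small ?(leq_ltn_trans _ plt) ?leq_addl ?leq_addr// => ab1.
by apply/ab/sd_eq => //; rewrite (core_sd a).1// (core_sd b).1.
Qed.

(** A scale where [a] and [b] agree divides a nonzero difference, so it is at
    most [a.1 + b.1], and below such a bound there are finitely many classes. *)
Lemma alpha_almost_free_sd : alpha_almost_free S.
Proof.
move=> a b ca cb ab; pose K := a.1 + b.1.
apply: sub_finite_set (finite_image (@sim_class S) (finite_sd_box K)).
move=> _ [[s _ <-] /(alpha_sd _ ca cb) sab].
have s0 := sd_scale_gt0 s.
have sK : scale s <= K.
  rewrite leqNgt; apply/negP => Ks; apply/ab/sd_eq.
    move: sab; rewrite !modn_small//; apply: leq_ltn_trans Ks.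
      exact: leq_addl.
    exact: leq_addr.
  by rewrite (core_sd a).1// (core_sd b).1.
exists (sd_int_part s).
  by split=> //=; rewrite (leq_trans _ sK)// ltnW// ltn_mod.
apply/(sim_classP right_LCM_sd)/sim_sd; split=> //=.
by rewrite modn_mod.
Qed.

Lemma sim_transversal_sd : sim_transversal (@core_irr1 S) [set: S].
Proof.
apply: sim_transversal_of_inj; last first.
  move=> s t /core_irr1_sd ss /core_irr1_sd tt /sim_sd[st].
  rewrite modn_small// st modn_small// => ?.
  exact: sd_eq.
split=> // s _; exists (sd_int_part s).
  by apply/core_irr1_sd; rewrite /= ltn_mod sd_scale_gt0.
by apply/sim_sd; split=> //=; rewrite modn_mod.
Qed.

(** If [a.1 + f.1 = i.1 + scale f * c.1] with [f.1 < scale f], then [c.1] is at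
    most [a.1], independently of [f]. *)
Lemma finite_core_parts_sd a : core a -> finite_set (core_parts core_irr1 a).
Proof.
move=> /core_sd a1; apply: sub_finite_set (finite_sd_box a.1.+1).
(* the box contains the default value 1 of [core_part], whose scale is 1: hence
   the successor *)
move=> _ [f /core_irr1_sd ff <-].
rewrite /core_part; case: xgetP => [c _|_]; last by [].
move=> [i [_ /core_sd c1 /[dup]]].
move=> /(congr1 (fun x : S => x.1)) + /(congr1 scale).
rewrite !fst_sd_mul !sd_scaleM a1 c1 muln1 !mul1n => E si.
split; last by rewrite /= c1.
rewrite /= leqW// -ltnS -(ltn_pmul2l (sd_scale_gt0 f)) {1}si.
rewrite (leq_ltn_trans (leq_addl i.1 _))// -E mulnS addnC -addSn.
by rewrite leq_add// leq_pmull// sd_scale_gt0.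
Qed.

Lemma finite_propagation_sd : finite_propagation S.
Proof.
move=> a b ca cb; exists core_irr1; split=> //.
- exact: sim_transversal_sd.
- exact: finite_core_parts_sd.
- exact: finite_core_parts_sd.
Qed.

End Semidirect.

(** * The zeta function *)

Section Zeta.
Variables (R : realType) (X : set nat).
Hypothesis X_gt1 : forall p, X p -> 1 < p.
Hypothesis X_coprime : forall p q, X p -> X q -> p <> q -> coprime p q.
Import numFieldNormedType.Exports.
Local Open Scope ring_scope.
Local Open Scope ereal_scope.

(** Collecting the powers of [x], one generator splits off; together with the next
    lemma this is the Euler factor of [x]. *)
Lemma submonoid_setU1 x (A : set nat) :
  submonoid (x |` A) = [set x ^ k.1 * k.2 | k in setT `*`` (fun=> submonoid A)]%N.
Proof.
apply/seteqP; split=> [n [s sA ->]|_ [[k _] [_ [s sA /= ->]] <-]].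
  exists (count_mem x s, \prod_(y <- [seq y <- s | y != x]) y)%N.
    split=> //=; exists [seq y <- s | y != x] => // y.
    by rewrite mem_filter => /andP[/eqP yx /sA[]].
  by rewrite -prod_count.
exists (nseq k x ++ s) => [y|].
  by rewrite mem_cat mem_nseq => /orP[/andP[_ /eqP->]|/sA]; [left|right].
by rewrite big_cat/= big_nseq iter_muln_1.
Qed.

Lemma inj_exp_mul x (A : set nat) : X x -> A `<=` X -> ~ A x ->
  set_inj (setT `*`` (fun=> submonoid A)) (fun k => x ^ k.1 * k.2)%N.
Proof.
move=> Xx AX Ax.
have cop n : submonoid A n -> coprime x n.
  move=> [s sA ->]; apply: (coprime_prod X_coprime) => // [y /sA/AX//|].
  by apply/negP => /sA.
have x0 : (0 < x)%N by rewrite ltnW ?X_gt1.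
have dvd k l m n : submonoid A n -> (x ^ k * m = x ^ l * n)%N -> (k <= l)%N.
  move=> An E; have : (x ^ k %| x ^ l * n)%N by rewrite -E dvdn_mulr.
  by rewrite Gauss_dvdl ?dvdn_Pexp2l ?X_gt1// coprimeXl// cop.
move=> [k m] [l n] /set_mem[_ /= Am] /set_mem[_ /= An] E.
have kl : k = l.
  by apply/eqP; rewrite eqn_leq (dvd _ _ _ _ An E) (dvd _ _ _ _ Am (esym E)).
move: E; rewrite kl => /eqP; rewrite eqn_pmul2l ?expn_gt0 ?x0// => /eqP -> //.
Qed.

Lemma esumZl (A : set nat) (a : nat -> \bar R) (c : R) :
  (0 <= c)%R -> (forall n, 0 <= a n) ->
  \esum_(n in A) (c%:E * a n) = c%:E * \esum_(n in A) a n.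
Proof.
move=> c0 a0; rewrite -(set_mem_set A).
rewrite -!nneseries_esum// ?nneseriesZl// => n _.
by rewrite mule_ge0// lee_fin.
Qed.

Lemma esum_geometric_fin (z : R) : (0 <= z)%R -> (z < 1)%R ->
  \esum_(k in [set: nat]) (z ^+ k)%:E < +oo.
Proof.
move=> z0 z1; rewrite -nneseries_esumT; last first.
  by move=> n; rewrite lee_fin exprn_ge0.
have cv : cvgn (series (geometric 1 z)).
  by apply: is_cvg_geometric_series; rewrite ger0_norm.
rewrite (_ : (fun _ => _) = EFin \o series (geometric 1 z)); last first.
  apply/funext => n /=; rewrite /series/= -sumEFin.
  by apply: eq_bigr => i _; rewrite mul1r.
by rewrite EFin_lim// ltry.
Qed.

(** Adding a generator [x] multiplies the sum by the geometric series of ratio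
    [x `^ (- s)], which is less than 1.  The list [L], which only has to cover
    [A], carries the induction on the finite set of generators. *)
Lemma zeta_fin (s : R) (L : seq nat) (A : set nat) : (0 < s)%R ->
  A `<=` [set` L] -> A `<=` X ->
  \esum_(n in submonoid A) (n%:R `^ (- s))%:E < +oo.
Proof.
move=> s0; elim: L A => [|x L IH] A AL AX.
  rewrite (_ : submonoid A = [set 1%N]); last first.
    apply/seteqP; split=> [n [[|y t] tA ->]|_ ->]; first by rewrite big_nil.
      by have := AL _ (tA y (mem_head _ _)).
    exact: submonoid_one.
  by rewrite esum_set1 ?ltry// lee_fin powR_ge0.
have [Ax|Ax] := pselect (A x); last first.
  apply: IH => // y Ay; have := AL _ Ay.
  by rewrite /= inE => /orP[/eqP yx|//]; rewrite yx in Ay.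
have Xx := AX _ Ax.
pose B := A `\ x.
have BL : B `<=` [set` L].
  by move=> y [Ay /= /eqP yx]; have := AL _ Ay; rewrite /= inE (negbTE yx).
have BX : B `<=` X by move=> y [/AX].
rewrite -(setD1K Ax) submonoid_setU1 esum_image; last first.
  by apply: inj_exp_mul => // -[_]; apply.
set z := (x%:R `^ (- s))%R.
have z0 : (0 <= z)%R by exact: powR_ge0.
have z1 : (z < 1)%R.
  rewrite /z powRN invf_lt1 ?powR_gt0 ?ltr0n ?(ltnW (X_gt1 Xx))//.
  have : (1 `^ s < x%:R `^ s)%R by rewrite gt0_ltr_powR ?nnegrE ?ler0n ?ltr1n ?X_gt1.
  by rewrite powR1.
(* [Z] is the sum over the remaining generators, finite by induction; it is
   used as a real factor. *)
pose Z := \esum_(n in submonoid B) (n%:R `^ (- s))%:E.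
have Z0 : 0 <= Z by apply: esum_ge0 => n _; rewrite lee_fin powR_ge0.
have ZE : (fine Z)%:E = Z by rewrite fineK// ge0_fin_numE// IH.
rewrite (_ : esum _ _ = (fine Z)%:E * \esum_(k in [set: nat]) (z ^+ k)%:E).
  rewrite lte_mul_pinfty ?lee_fin ?fine_ge0//.
  exact: esum_geometric_fin.
rewrite -esumZl ?fine_ge0//; last by move=> n; rewrite lee_fin exprn_ge0.
transitivity (\esum_(k in [set: nat]) \esum_(m in submonoid B)
    ((z ^+ k)%:E * (m%:R `^ (- s))%:E)).
  rewrite esum_esum; last first.
    by move=> k m _ _; rewrite -EFinM lee_fin mulr_ge0 ?powR_ge0 ?exprn_ge0.
  apply: eq_esum => k _; rewrite -EFinM natrM natrX powRM ?exprn_ge0 ?ler0n//.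
  congr (_ * _)%:E.
  by rewrite -powR_mulrn ?ler0n// -powRrM mulrC powRrM powR_mulrn ?powR_ge0.
apply: eq_esum => k _; rewrite esumZl ?exprn_ge0//.
by rewrite ZE muleC.
Qed.

(** All terms are 1 and the powers of one generator are already infinitely
    many. *)
Lemma zeta_1 : X !=set0 -> \esum_(n in submonoid X) (n%:R `^ 0)%:E = +oo :> \bar R.
Proof.
move=> [x Xx]; apply/eqyP => r r0; apply: esum_ge.
have inj : set_inj `I_(Num.bound r) (expn x).
  by move=> k l _ _ /eqP; rewrite eqn_exp2l ?X_gt1// => /eqP.
exists (expn x @` `I_(Num.bound r)).
  split; first exact/finite_image/finite_II.
  by move=> _ [k _ <-]; exact: submonoid_exp.
rewrite fsbig_image// -fsbig_ord sumEFin lee_fin.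
under eq_bigr do rewrite powRr0.
by rewrite sumr_const card_ord ltW// archi_boundP// ltW.
Qed.

Lemma critical_inverse_temperature_sd : X !=set0 -> finite_set X ->
  critical_inverse_temperature (@sd_scale X) (1%:E : \bar R).
Proof.
move=> X0 /finite_seqP[L XL]; split=> [beta|b bfin].
  rewrite lte_fin -subr_gt0 /zeta range_sd_scale => s0.
  by apply: (zeta_fin (L := L)) => //; rewrite XL.
rewrite leNgt; apply/negP => b1.
(* a bound below 1 would make the sum at 1 itself finite *)
by have := bfin 1%R b1; rewrite /zeta range_sd_scale subrr oppr0 zeta_1// ltxx.
Qed.

End Zeta.

Theorem proposition5p9 (R : realType) (calP : set nat)
    (calP_neq0 : calP !=set0)
    (calP_gt1 : forall p, calP p -> (1 < p)%N)
    (calP_coprime : forall p q, calP p -> calP q -> p <> q -> coprime p q) :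
  let S : monoidType := semidirect calP in
  let N : S -> nat := @sd_scale calP in
  right_LCM S /\
  [/\ (* (i) *)
      admissible N /\
      (finite_set calP -> critical_inverse_temperature N (1%:E : \bar R)),
      (* (ii) *)
      alpha_faithful S /\ alpha_almost_free S &
      (* (iii) *)
      finite_propagation S].
Proof.
move=> S N; split; first exact: right_LCM_sd.
split; last exact: finite_propagation_sd.
- split; first exact: admissible_sd.
  by move=> finP; exact: critical_inverse_temperature_sd.
- by split; [exact: alpha_faithful_sd|exact: alpha_almost_free_sd].
Qed.
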